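(* For each integer $d\geq 2$, let \[p_d(x)=1-x-\sum_{i=\left\lfloor\frac{d}{2}\right\rfloor+2}^dx^i-\sum_{i=\left\lceil\frac{d}{2}\right\rceil+1}^dx^i,\] and let $\rho_d=1/x_d$, where $x_d$ is the smallest positive real root of $p_d(x)$. Let $L_d(k)$ denote the number of vertices of the tree $\Lambda_d(k)$. For each fixed $d$, we have \[N_{[d]}^{\mathrm{con}}(k)\leq L_d(k)=(\rho_d+o(1))^k,\] where the inequality holds for all $k\geq 1$ and $o(1)\to 0$ as $k\to\infty$. Furthermore, as $d\to\infty$, we have \[\rho_d=1+\frac{4\log d}{d}-\frac{4\log\log d}{d}+o\left(\frac{\log\log d}{d}\right).\]
   Context: Here $\log$ is the natural logarithm and empty sums are $0$. Let $d\geq 2$ be an integer. A $[d]$-tree is a rooted tree in which the children of each vertex are linearly ordered from left to right and the number of children of each vertex is an element of $\{0,1,\dots,d\}$. Every connected induced subgraph $T^*$ of a $[d]$-tree $\mathcal T$ is itself a $[d]$-tree (rooted at its vertex closest to the root of $\mathcal T$, with the inherited order of children). If $T^*$ is isomorphic as a $[d]$-tree (preserving root and order of children) to a $[d]$-tree $T$, then $\mathcal T$ is said to contiguously contain $T$. $N_{[d]}^{\mathrm{con}}(k)$ denotes the minimum number of vertices in a $[d]$-tree that contiguously contains every $[d]$-tree with $k$ vertices. The $[d]$-trees $\Lambda_d(k)$ are defined recursively. $\Lambda_d(1)$ is a single vertex. For $2\leq k\leq d$, $\Lambda_d(k)$ is obtained by attaching to a root, in this order from left to right, the subtrees \[\Lambda_d(1),\Lambda_d(2),\ldots,\Lambda_d\left(\left\lfloor\tfrac{k}{2}\right\rfloor-1\right),\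 \ \Lambda_d(k-1),\ \ \Lambda_d\left(\left\lceil\tfrac{k}{2}\right\rceil-1\right),\Lambda_d\left(\left\lceil\tfrac{k}{2}\right\rceil-2\right),\ldots,\Lambda_d(1).\] For $k>d$, $\Lambda_d(k)$ is obtained by attaching to a root, in this order from left to right, the subtrees \[\Lambda_d(k-d),\Lambda_d(k-d+1),\ldots,\Lambda_d\left(k-\left\lfloor\tfrac{d}{2}\right\rfloor-2\right),\ \ \Lambda_d(k-1),\ \ \Lambda_d\left(k-\left\lceil\tfrac{d}{2}\right\rceil-1\right),\Lambda_d\left(k-\left\lceil\tfrac{d}{2}\right\rceil-2\right),\ldots,\Lambda_d(k-d).\] (An increasing list whose last index is smaller than its first index, or a decreasing list whose last index is larger than its first index, is empty.) *)

(* Defs.v *)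
From HB Require Import structures.
From mathcomp Require Import all_boot all_order all_algebra.
From mathcomp Require Import all_classical all_reals all_analysis.
From mathcomp Require Import zify lra.
Set Implicit Arguments.
Unset Strict Implicit.
Unset Printing Implicit Defensive.
Import Order.TTheory GRing.Theory Num.Theory.
Import numFieldNormedType.Exports.

(* Finite rooted plane trees; the list gives the children from left to right, *)
(* so that two plane trees are isomorphic iff they are equal in [ptree].      *)
Inductive ptree : Type := Node of seq ptree.

Definition children (t : ptree) : seq ptree := let: Node ts := t in ts.
Definition leaf : ptree := Node [::].

Fixpoint is_dtree (d : nat) (t : ptree) : bool :=
  let: Node ts := t in (size ts <= d) && all (is_dtree d) ts.

(* A vertex is identified with its address: [::] is the root, and i :: v is   *)
(* the vertex of address v in the subtree of the i-th child of the root.      *)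
Fixpoint verts (t : ptree) : seq (seq nat) :=
  let: Node ts := t in
  [::] :: flatten
    (mkseq (fun i => [seq i :: v | v <- nth [::] (map verts ts) i]) (size ts)).

Definition nverts (t : ptree) : nat := size (verts t).

Lemma verts_Node ts : verts (Node ts) =
  [::] :: flatten (mkseq (fun i => [seq i :: v | v <- verts (nth leaf ts i)])
                     (size ts)).
Proof.
rewrite /=; congr (_ :: flatten _); apply/eq_in_map => i.
by rewrite mem_iota /= add0n => ilt; rewrite (nth_map leaf).
Qed.

Lemma nverts_Node ts : nverts (Node ts) = (sumn (map nverts ts)).+1.
Proof.
rewrite /nverts verts_Node /= size_flatten /shape -map_comp; congr (sumn _).+1.
rewrite -[in RHS](mkseq_nth leaf ts) -map_comp; apply: eq_map => i /=.
by rewrite size_map.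
Qed.

Lemma nverts_nth ts i : i < size ts -> nverts (nth leaf ts i) < nverts (Node ts).
Proof.
rewrite nverts_Node ltnS; elim: ts i => //= t ts IH [_|i]; first exact: leq_addr.
by rewrite ltnS => /IH /leq_trans; apply; rewrite leq_addl.
Qed.

Lemma root_in_verts t : [::] \in verts t.
Proof. by case: t => ts; rewrite inE. Qed.

Lemma cons_in_verts i v t : (i :: v \in verts t) =
  (i < size (children t)) && (v \in verts (nth leaf (children t) i)).
Proof.
case: t => ts; rewrite verts_Node inE /=; apply/flattenP/andP => /=.
  move=> [s /mapP [j]]; rewrite mem_iota add0n /= => jlt -> /mapP [w win].
  by case=> -> ->.
move=> [ilt vin]; exists [seq i :: w | w <- verts (nth leaf ts i)].
  by apply/mapP; exists i; rewrite ?mem_iota.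
by apply: map_f.
Qed.

Lemma verts_uniq t : uniq (verts t).
Proof.
have [n] := ubnP (nverts t); elim: n => // n IHn in t *.
case: t => ts szn; rewrite verts_Node /=.
apply/andP; split.
  by apply/negP => /flattenP [s /mapP [i _ ->] /mapP [w]].
apply: (@allpairs_uniq_dep _ (fun=> seq nat) _ (fun i v => i :: v)).
- exact: iota_uniq.
- move=> i; rewrite mem_iota add0n /= => ilt; apply: IHn.
  by apply: leq_trans (nverts_nth ilt) _; rewrite -ltnS.
- by move=> [i v] [j w] _ _ /= [-> ->].
Qed.

Lemma rcons_in_verts v i t : rcons v i \in verts t -> v \in verts t.
Proof.
elim: v t => [|j v IH] t; first by rewrite root_in_verts.
by rewrite /= !cons_in_verts => /andP [-> /IH].
Qed.

Definition vertex (t : ptree) : finType := seq_sub (verts t).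

Definition root_vertex (t : ptree) : vertex t := SeqSub (root_in_verts t).

Definition depth (t : ptree) (v : vertex t) : nat := size (val v).

Definition is_child (t : ptree) : rel (vertex t) :=
  [rel v w | prefix (val v) (val w) && (depth w == (depth v).+1)].

Definition adjacent (t : ptree) : rel (vertex t) :=
  [rel v w | is_child v w || is_child w v].

(* Meaningful only when v and w are children of the same vertex, in which     *)
(* case their addresses differ at most by their last entry.                   *)
Definition left_of (t : ptree) : rel (vertex t) :=
  [rel v w | last 0 (val v) < last 0 (val w)].

Definition induced_connected (t : ptree) (S : {set vertex t}) : Prop :=
  S != finset.set0 /\
  {in S &, forall v w,
     connect [rel x y | [&& x \in S, y \in S & adjacent x y]] v w}.

(* f is an isomorphism from T onto the subtree of t induced by the connected  *)
(* set S, rooted at its vertex closest to the root of t, with the inherited   *)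
(* order of children.                                                         *)
Definition iso_onto_induced (T t : ptree) (S : {set vertex t})
    (f : vertex T -> vertex t) : Prop :=
  [/\ injective f,
      [set f v | v : vertex T] = S,
      forall v, v \in S -> depth (f (root_vertex T)) <= depth v,
      forall v w, is_child (f v) (f w) = is_child v w
    & forall u v w, is_child u v -> is_child u w ->
        left_of (f v) (f w) = left_of v w].

Definition contiguously_contains (t T : ptree) : Prop :=
  exists S : {set vertex t}, induced_connected S /\
  exists f : vertex T -> vertex t, iso_onto_induced S f.

Definition con_universal (d k : nat) (t : ptree) : Prop :=
  is_dtree d t /\
  forall T, is_dtree d T -> nverts T = k -> contiguously_contains t T.

Lemma contains_sub t T :
  {subset verts T <= verts t} -> contiguously_contains t T.
Proof.
move=> sub; pose f (v : vertex T) : vertex t := SeqSub (sub _ (valP v)).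
exists [set f v | v : vertex T]; split.
  split; first by apply/set0Pn; exists (f (root_vertex T)); apply: imset_f.
  set e := (X in connect X).
  have e_sym : symmetric e.
    by move=> x y; rewrite /e /adjacent /= orbC andbCA.
  have to_root v (vT : v \in verts T) : connect e (f (root_vertex T)) (f (SeqSub vT)).
    elim/last_ind: v => [|v i IH] in vT *.
      by rewrite (_ : SeqSub vT = root_vertex T) //; apply: val_inj.
    have vT' := rcons_in_verts vT.
    apply: connect_trans (IH vT') (connect1 _).
    rewrite /e /= !imset_f //= /adjacent /= /is_child /= /depth /=.
    by rewrite prefix_rcons size_rcons eqxx.
  move=> _ _ /imsetP [v _ ->] /imsetP [w _ ->].
  case: v w => [v vT] [w wT].
  by apply: connect_trans (to_root _ wT); rewrite (sym_connect_sym e_sym).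
exists f; split=> //.
by move=> v w /(congr1 val) /= vw; apply: val_inj.
Qed.

Fixpoint complete_tree (d n : nat) : ptree :=
  if n is n'.+1 then Node (nseq d (complete_tree d n')) else leaf.

Lemma complete_tree_universal d k : con_universal d k (complete_tree d k).
Proof.
split.
  by elim: k => //= n IH; rewrite size_nseq leqnn all_nseq IH orbT.
move=> T dT /eq_leq szT; apply: contains_sub => v.
elim: v k T dT szT => [|i v IH] k [ts]; first by rewrite !root_in_verts.
rewrite !cons_in_verts /= => /andP [szts /(all_nthP leaf) dts] szT /andP [ilt vin].
have := leq_trans (nverts_nth ilt) szT; case: k {szT} => //= k; rewrite ltnS => szt.
have id := leq_trans ilt szts.
rewrite size_nseq id nth_nseq id /=; apply: IH szt vin.
exact: dts.
Qed.

Lemma con_number_exists d k :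
  exists n, `[< exists t, con_universal d k t /\ nverts t = n >].
Proof.
exists (nverts (complete_tree d k)); apply/asboolP.
by exists (complete_tree d k); split=> //; apply: complete_tree_universal.
Qed.

Definition Ncon (d k : nat) : nat := ex_minn (con_number_exists d k).

(* The first argument is recursion fuel; [Lambda1], [Lambda_small] and        *)
(* [Lambda_large] below are the recursive definition of the trees.            *)
Fixpoint Lambda_rec (n d k : nat) : ptree :=
  if n is n'.+1 then
    if k <= 1 then leaf
    else if k <= d then
      Node (map (Lambda_rec n' d) (index_iota 1 k./2) ++
            Lambda_rec n' d k.-1 ::
            map (Lambda_rec n' d) (rev (index_iota 1 (uphalf k))))
    else
      Node (map (Lambda_rec n' d) (index_iota (k - d) (k - d./2 - 1)) ++
            Lambda_rec n' d k.-1 ::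
            map (Lambda_rec n' d) (rev (index_iota (k - d) (k - uphalf d))))
  else leaf.

Definition Lambda (d k : nat) : ptree := Lambda_rec k d k.

Lemma Lambda_rec_fuel n m d k : 1 < d -> k <= n -> k <= m ->
  Lambda_rec n d k = Lambda_rec m d k.
Proof.
move=> d1; elim: n m k => [|n IH] [|m] k //=.
- by rewrite leqn0 => /eqP ->.
- by move=> _; rewrite leqn0 => /eqP ->.
move=> kn km; case: ltnP => // k1.
have lt_eq j : j < k -> Lambda_rec n d j = Lambda_rec m d j.
  by move=> jk; apply: IH; rewrite -ltnS; apply: leq_trans jk _.
have map_eq a b : b <= k -> map (Lambda_rec n d) (index_iota a b) =
    map (Lambda_rec m d) (index_iota a b).
  move=> bk; apply/eq_in_map => j; rewrite mem_index_iota => /andP [_ jb].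
  exact: lt_eq (leq_trans jb bk).
rewrite lt_eq; last by case: (k) k1.
have uk : uphalf k <= k by rewrite leq_uphalf_double -addnn leq_addr.
by case: leqP => kd; rewrite !map_rev !map_eq //; lia.
Qed.

Lemma Lambda1 d : Lambda d 1 = leaf.
Proof. by []. Qed.

Lemma map_Lambda_rec d k a b : 1 < d -> 1 < k -> b <= k ->
  map (Lambda_rec k.-1 d) (index_iota a b) = map (Lambda d) (index_iota a b).
Proof.
move=> d1 k1 bk; apply/eq_in_map => j; rewrite mem_index_iota => jb.
by apply: Lambda_rec_fuel => //; lia.
Qed.

Lemma Lambda_small d k : 1 < d -> 2 <= k <= d ->
  Lambda d k = Node ([seq Lambda d j | j <- index_iota 1 k./2] ++
                     Lambda d k.-1 ::
                     [seq Lambda d j | j <- rev (index_iota 1 (uphalf k))]).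
Proof.
move=> d1 /andP [k1 kd].
have uk : uphalf k <= k by rewrite leq_uphalf_double -addnn leq_addr.
have -> : Lambda d k = Lambda_rec k.-1.+1 d k by rewrite (ltn_predK k1).
rewrite /= leqNgt k1 kd /= !map_rev !map_Lambda_rec //; lia.
Qed.

Lemma Lambda_large d k : 1 < d -> d < k ->
  Lambda d k =
  Node ([seq Lambda d j | j <- index_iota (k - d) (k - d./2 - 1)] ++
        Lambda d k.-1 ::
        [seq Lambda d j | j <- rev (index_iota (k - d) (k - uphalf d))]).
Proof.
move=> d1 dk; have k1 := ltn_trans d1 dk.
have -> : Lambda d k = Lambda_rec k.-1.+1 d k by rewrite (ltn_predK k1).
rewrite /= leqNgt k1 leqNgt dk /= !map_rev !map_Lambda_rec //; lia.
Qed.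

Definition L_ (d k : nat) : nat := nverts (Lambda d k).

Local Open Scope ring_scope.

Definition p_ (R : realType) (d : nat) : {poly R} :=
  1 - 'X - \sum_(d./2 + 2 <= i < d.+1) 'X^i
         - \sum_(uphalf d + 1 <= i < d.+1) 'X^i.

Definition smallest_pos_root (R : realType) (q : {poly R}) (x : R) : Prop :=
  [/\ 0 < x, root q x & forall y, 0 < y -> root q y -> x <= y].

Lemma horner_p (R : realType) d (x : R) : (p_ R d).[x] =
  1 - x - \sum_(d./2 + 2 <= i < d.+1) x ^+ i
        - \sum_(uphalf d + 1 <= i < d.+1) x ^+ i.
Proof.
rewrite /p_ !hornerE !horner_sum.
by congr (_ - _ - _); apply: eq_bigr => i _; rewrite hornerXn.
Qed.

Lemma smallest_pos_root_p (R : realType) d :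
  exists x, smallest_pos_root (p_ R d) x.
Proof.
have sum_ge0 a b (x : R) : 0 <= x -> 0 <= \sum_(a <= i < b) x ^+ i.
  by move=> x0; apply: sumr_ge0 => i _; apply: exprn_ge0.
have sum_le a b (x y : R) : 0 <= x -> x <= y ->
    \sum_(a <= i < b) x ^+ i <= \sum_(a <= i < b) y ^+ i.
  by move=> x0 xy; apply: ler_sum => i _; rewrite lerXn2r ?nnegrE ?(le_trans x0).
have sum0 a b : (0 < a)%N -> \sum_(a <= i < b) (0 : R) ^+ i = 0.
  move=> a0; rewrite big_nat_cond big1 // => i /andP [/andP [ai _] _].
  by rewrite expr0n; case: i ai => //; rewrite leqNgt a0.
have p0 : (p_ R d).[0] = 1.
  by rewrite horner_p !sum0 ?subr0 // ?addn1 ?addn2.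
have p1 : (p_ R d).[1] <= 0.
  have := sum_ge0 (d./2 + 2)%N d.+1 1 ler01.
  have := sum_ge0 (uphalf d + 1)%N d.+1 1 ler01.
  by rewrite horner_p; lra.
have pN0 : (- p_ R d).[0] <= 0 <= (- p_ R d).[1].
  by rewrite !hornerN p0; apply/andP; split; lra.
have [x /andP [x0 x1]] := poly_ivt ler01 pN0.
rewrite rootN => /[dup] rx /rootP px.
have {}x0 : 0 < x.
  rewrite lt_neqAle x0 andbT; apply/eqP => xE.
  by move: px; rewrite -xE p0 => /eqP; rewrite oner_eq0.
exists x; split=> // y y0 /rootP py; rewrite leNgt; apply/negP => yx.
have := sum_le (d./2 + 2)%N d.+1 _ _ (ltW y0) (ltW yx).
have := sum_le (uphalf d + 1)%N d.+1 _ _ (ltW y0) (ltW yx).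
move: px py; rewrite !horner_p; lra.
Qed.

Definition x_ (R : realType) (d : nat) : R :=
  xget 0 [set x | smallest_pos_root (p_ R d) x]%classic.

Lemma x_P (R : realType) d : smallest_pos_root (p_ R d) (x_ R d).
Proof. exact: xgetPex (smallest_pos_root_p R d). Qed.

Definition rho_ (R : realType) (d : nat) : R := (x_ R d)^-1.

(* Main.v *)
Require Import Defs.
From mathcomp Require Import all_boot all_order all_algebra.
From mathcomp Require Import all_classical all_reals all_analysis.
From mathcomp Require Import zify ring lra.
Set Implicit Arguments.
Unset Strict Implicit.
Unset Printing Implicit Defensive.
Import Order.TTheory GRing.Theory Num.Theory.
Import numFieldNormedType.Exports.

(** The universality of the tree of index [k] is proved in a stronger form that
supports induction: every tree with at most [k] vertices embeds in it with root
sent to root ([Lambda_embedding]).  The subtrees at the root of such a tree have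
sizes [s_1, ..., s_m] of sum at most [k - 1], and they must be sent, in order, to
root subtrees of [Lambda d k] of at least the same index; these indices are
[K, K + 1, ...] increasing, then [k - 1], then a list decreasing to [K], where [K]
is 1 or [k - d].  On an increasing run starting at [K], a subtree of size [s] can
be placed within the next [room K s = 1 + (s - K)] positions (truncated
subtraction): the last of them has index at least [s].  So the subtrees are put
greedily on the left run until the first one that overflows it; that one takes
the big middle slot, and the remaining ones are put greedily, from the right end,
on the decreasing run ([fits_slots]).  It remains to see that the total room
needed does not exceed the number of slots ([sum_room]).

For the growth rate, counting vertices turns the definition of the trees into a
linear recurrence with the constant term 1, whose characteristic polynomial is the
reciprocal of [p_] ([L_rec]).  Since [x = x_ R d] is a root of [p_], the geometric
sequence [c / x ^+ k] solves the homogeneous recurrence.  It is compared by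
induction with [L_] from below and with [L_ + 1] from above; adding 1 absorbs the
constant term, because there are [d >= 2] terms on the right-hand side.  So
[L_ d k * x ^+ k] stays between two positive constants and its [k]-th root tends
to 1.

For the asymptotics in [d], [p_] decreases on the positive half line, so the
position of [rho_ R d] with respect to [1 + u] is given by the sign of [p_] at
[(1 + u)^-1].  Summing the geometric progressions, this sign is that of
[u ^+ 2 - 2 (1 + u) ^- (d / 2)] up to constant factors, and
[(1 + u) ^- (d / 2)] is close to [expR (- u d / 2)].  With
[u = 4 (ln d - ln (ln d)) / d] the two terms are both of order
[(ln d / d) ^+ 2]; changing [u] by [delta * ln (ln d) / d] changes the second
one by the factor [(ln d) ^ (-+ delta / 2)], which beats every constant
([rho_bounds]). *)

(** * Fitting sizes into slots *)

Definition fits (s c : seq nat) : Prop :=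
  exists2 c', subseq c' c & all2 leq s c'.

Lemma fits_cat s1 s2 c1 c2 :
  fits s1 c1 -> fits s2 c2 -> fits (s1 ++ s2) (c1 ++ c2).
Proof.
move=> [c1' sub1 le1] [c2' sub2 le2]; exists (c1' ++ c2'); first exact: cat_subseq.
move: le1 le2; rewrite !all2E !size_cat => /andP [/eqP sz1 le1] /andP [/eqP sz2 le2].
by rewrite zip_cat // all_cat le1 le2 sz1 sz2 eqxx.
Qed.

Lemma fits_rev s c : fits s c -> fits (rev s) (rev c).
Proof.
move=> [c' sub le]; exists (rev c'); first by rewrite subseq_rev.
move: le; rewrite !all2E !size_rev => /andP [/eqP sz le].
by rewrite -rev_zip // all_rev le sz eqxx.
Qed.

Lemma fits_nil c : fits [::] c.
Proof. by exists [::]; rewrite ?sub0seq. Qed.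

Lemma fits1 x c y : y \in c -> x <= y -> fits [:: x] c.
Proof. by move=> yc xy; exists [:: y]; rewrite ?sub1seq //= xy. Qed.

(** How many consecutive places of an increasing run starting at [K] are set aside
for an item of size [x]: the last of them has capacity at least [x], wherever in
the run they lie. *)
Definition room (K x : nat) : nat := (x - K).+1.

Lemma fits_iota K a s : sumn (map (room K) s) <= a -> fits s (iota K a).
Proof.
elim/last_ind: s a => [|s x IH] a; first by move=> _; apply: fits_nil.
rewrite map_rcons sumn_rcons => sa; rewrite -cats1.
have -> : a = (a - room K x) + room K x by lia.
rewrite iotaD; apply: fits_cat; first by apply: IH; lia.
by apply: (@fits1 _ _ (K + a - 1)); rewrite ?mem_iota /room in sa *; lia.
Qed.

Lemma split_prefix (f : nat -> nat) s a : a < sumn (map f s) ->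
  exists s1 x s2, [/\ s = s1 ++ x :: s2, sumn (map f s1) <= a &
                      a < sumn (map f s1) + f x].
Proof.
elim: s a => [//|x s IH] a /= lt.
have [ax|xa] := ltnP a (f x); first by exists [::], x, s.
have [|s1 [y [s2 [-> le1 lt1]]]] := IH (a - f x); first by lia.
by exists (x :: s1), y, s2; split=> //=; lia.
Qed.

(** The items go to the left run until one overflows it.  That one goes to the
middle, and since the items up to it use more than [a] units of room, at most [b]
units are left for the items after it, which go to the right run read backwards. *)
Lemma fits_slots K a b m s : all (leq^~ m) s ->
  sumn (map (room K) s) <= a + b + 1 ->
  fits s (iota K a ++ m :: rev (iota K b)).
Proof.
move=> /allP sm sab.
have [sa|/split_prefix [s1 [x [s2 [sE s1a ax]]]]] := leqP (sumn (map (room K) s)) a.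
  by rewrite -[s]cats0; apply: fits_cat (fits_iota sa) (fits_nil _).
move: sab; rewrite sE map_cat sumn_cat /= => sab.
apply: fits_cat (fits_iota s1a) _; rewrite -cat1s -[m :: _]cat1s.
apply: fits_cat.
  by apply: (@fits1 _ _ m); rewrite ?inE //; apply: sm; rewrite sE mem_cat inE eqxx orbT.
by rewrite -[s2]revK; apply/fits_rev/fits_iota; rewrite map_rev sumn_rev; lia.
Qed.

Lemma size_le_sumn s : all (leq 1) s -> size s <= sumn s.
Proof. by elim: s => //= x s IH /andP [x1 /IH]; lia. Qed.

(** If no item exceeds [K], each takes one unit of room.  Otherwise an item larger
than [K] takes [K - 1] units less than its size, and no item takes more than its
size. *)
Lemma sum_room K s : all (leq 1) s -> 0 < K ->
  sumn (map (room K) s) = size s \/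
  sumn (map (room K) s) + K.-1 <= sumn s.
Proof.
move=> + K0; elim: s => [|x s IH] /=; first by left.
by move=> /andP [x1 /[dup] /size_le_sumn + /IH]; rewrite /room; lia.
Qed.

(** Positions, rather than a mask, are what an embedding of addresses uses. *)
Lemma subseq_pos (c' c : seq nat) : subseq c' c -> exists pos : nat -> nat,
  (forall i, i < size c' -> pos i < size c /\ nth 0 c' i = nth 0 c (pos i)) /\
  (forall i j, i < j < size c' -> pos i < pos j).
Proof.
elim: c c' => [|y c IH] [|x c'] //=; try by move=> _; exists id; split => // i j; lia.
case: eqP => [<-|_] /IH [pos [posn posm]].
  exists (fun i => if i is i'.+1 then (pos i').+1 else 0); split.
    by case=> [|i] //=; rewrite ltnS => /posn.
  by case=> [|i] [|j] //=; rewrite !ltnS => /posm.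
by exists (fun i => (pos i).+1); split => [i /posn|i j /posm].
Qed.

(** Both cases of the recursive definition have the same shape; only the least
index on the two sides and the number of slots differ. *)
Lemma Lambda_slots d k : 1 < d -> 1 < k -> exists a b,
  a + b + 1 = minn d k.-1 /\
  Lambda d k = Node (map (Lambda d)
    (iota (maxn 1 (k - d)) a ++ k.-1 :: rev (iota (maxn 1 (k - d)) b))).
Proof.
move=> d1 k1; have [kd|dk] := leqP k d.
  exists (k./2 - 1), (uphalf k - 1); split; first by lia.
  rewrite Lambda_small ?k1 ?kd // map_cat /=.
  by have -> : maxn 1 (k - d) = 1 by lia.
exists (k - d./2 - 1 - (k - d)), (k - uphalf d - (k - d)); split; first by lia.
by rewrite Lambda_large // map_cat /=; have -> : maxn 1 (k - d) = k - d by lia.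
Qed.

(** * Embeddings that send root to root *)

(** In terms of addresses: a child of [v] goes to a child of [g v], and [g] is
strictly increasing on the children of each vertex, so that children may be
skipped but not permuted.  Only the values of [g] on the addresses of [T] matter. *)
Definition rooted_embedding (T t : ptree) (g : seq nat -> seq nat) : Prop :=
  [/\ g [::] = [::],
      {in verts T, forall v, g v \in verts t},
      forall v i, rcons v i \in verts T ->
        g (rcons v i) = rcons (g v) (last 0 (g (rcons v i)))
    & forall v i j, rcons v i \in verts T -> rcons v j \in verts T -> i < j ->
        last 0 (g (rcons v i)) < last 0 (g (rcons v j))].

(** Embeddings of the root subtrees into subtrees at increasing positions are glued
by translating the first entry of an address by [pos]. *)
Lemma rooted_embedding_node ts us (pos : nat -> nat) :
  (forall i j, i < j < size ts -> pos i < pos j) ->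
  (forall i, i < size ts -> pos i < size us /\
     exists g, rooted_embedding (nth leaf ts i) (nth leaf us (pos i)) g) ->
  exists g, rooted_embedding (Node ts) (Node us) g.
Proof.
move=> pos_incr emb.
have /choice [G GP] : forall i, exists g, i < size ts ->
    rooted_embedding (nth leaf ts i) (nth leaf us (pos i)) g.
  move=> i; have [/emb [_ [g gP]]|] := ltnP i (size ts); first by exists g.
  by move=> _; exists id.
exists (fun v => if v is i :: w then pos i :: G i w else [::]); split=> //.
- case=> [|i v]; first by rewrite !root_in_verts.
  rewrite !cons_in_verts /= => /andP [its vT]; have [-> _] := emb i its.
  by have [_ gv _ _] := GP i its; rewrite gv.
- case=> [|i v] j.
    by rewrite [rcons _ _]/= cons_in_verts /= => /andP [/GP [-> _ _ _]].
  rewrite rcons_cons cons_in_verts /= => /andP [its vT].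
  by have [_ _ gr _] := GP i its; rewrite (gr _ _ vT) last_rcons.
- case=> [|i v] j l; rewrite ?rcons_cons ?[rcons [::] _]/= !cons_in_verts /=.
    move=> /andP [jts _] /andP [lts _] jl.
    have [[-> _ _ _] [-> _ _ _]] := (GP j jts, GP l lts) => /=.
    by apply: pos_incr; rewrite jl.
  move=> /andP [its vT] /andP [_ wT] jl; have [_ _ gr /(_ _ _ _ vT wT jl)] := GP i its.
  by rewrite (gr _ _ vT) (gr _ _ wT) !last_rcons.
Qed.

Lemma rooted_embedding_size T t g v : rooted_embedding T t g ->
  v \in verts T -> size (g v) = size v.
Proof.
move=> [g0 _ gr _]; elim/last_ind: v => [|v i IH]; first by rewrite g0.
by move=> vT; rewrite (gr _ _ vT) !size_rcons IH // (rcons_in_verts vT).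
Qed.

Lemma rooted_embedding_inj T t g : rooted_embedding T t g ->
  {in verts T &, injective g}.
Proof.
move=> gP v w; have szg := rooted_embedding_size gP; case: (gP) => _ _ gr gm.
elim/last_ind: v w => [|v i IH]; elim/last_ind => [|w j _] //.
- by move=> vT wT /(congr1 size); rewrite !szg // size_rcons.
- by move=> vT wT /(congr1 size); rewrite !szg // size_rcons.
move=> vT wT /[dup] eqg; rewrite (gr _ _ vT) (gr _ _ wT) => /rcons_inj [eqvw _].
have eqv := IH _ (rcons_in_verts vT) (rcons_in_verts wT) eqvw.
rewrite -eqv in wT eqg *; congr rcons.
by case: (ltngtP i j) => // [/(gm _ _ _ vT wT)|/(gm _ _ _ wT vT)]; rewrite eqg ltnn.
Qed.

Lemma is_childP t (v w : vertex t) :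
  reflect (exists i, val w = rcons (val v) i) (is_child v w).
Proof.
apply: (iffP andP) => [[/prefixP [s wE]]|[i wE]]; last first.
  by rewrite /depth wE prefix_rcons size_rcons eqxx.
rewrite /depth wE size_cat -addn1 eqn_add2l.
by case: s wE => [|i [|j s]] // wE _; exists i; rewrite -cats1.
Qed.

Lemma rooted_embedding_contains T t g : rooted_embedding T t g ->
  contiguously_contains t T.
Proof.
move=> gP; have ginj := rooted_embedding_inj gP.
have szg := rooted_embedding_size gP.
case: gP => g0 gin gr gm.
pose f (v : vertex T) : vertex t := SeqSub (gin _ (valP v)).
have f_child v w : is_child (f v) (f w) = is_child v w.
  apply/is_childP/is_childP => /= -[i].
    case: v w => [v vT] [w wT] /=; elim/last_ind: w => [|w j _] in wT *.
      by rewrite g0; case: (g v).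
    rewrite (gr _ _ wT) => /rcons_inj [/(ginj _ _ (rcons_in_verts wT) vT) -> _].
    by exists j.
  case: v w => [v vT] [w wT] /= wE; rewrite wE in wT *.
  by rewrite (gr _ _ wT); eexists.
exists [set f v | v : vertex T]%SET; split.
  split; first by apply/set0Pn; exists (f (root_vertex T)); apply: imset_f.
  set e := (X in connect X).
  have e_sym : symmetric e by move=> x y; rewrite /e /Defs.adjacent /= orbC andbCA.
  have to_root v (vT : v \in verts T) :
      connect e (f (root_vertex T)) (f (SeqSub vT)).
    elim/last_ind: v => [|v i IH] in vT *.
      by rewrite (_ : SeqSub vT = root_vertex T) //; apply: val_inj.
    have vT' := rcons_in_verts vT.
    apply: connect_trans (IH vT') (connect1 _).
    rewrite /e /= !imset_f //= /Defs.adjacent /=; apply/orP; left.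
    by rewrite f_child; apply/is_childP; exists i.
  move=> _ _ /imsetP [v _ ->] /imsetP [w _ ->]; case: v w => [v vT] [w wT].
  by apply: connect_trans (to_root _ wT); rewrite (sym_connect_sym e_sym).
exists f; split=> //.
- by move=> v w /(congr1 val) /= /(ginj _ _ (valP v) (valP w)) /val_inj.
- by move=> v _; rewrite /depth /= g0.
move=> [u uT] [v vT] [w wT] /is_childP [i /= vE] /is_childP [j /= wE].
rewrite /left_of /= !vE !wE in vT wT *; rewrite !last_rcons.
case: (ltngtP i j) => [||->]; last by rewrite ltnn.
  exact: gm.
by move=> /(gm _ _ _ wT vT) /ltnW /leq_gtF.
Qed.

Lemma nverts_gt0 t : 0 < nverts t.
Proof. by case: t => ts; rewrite nverts_Node. Qed.

(** Bounding the number of vertices by [k], instead of fixing it, is what makes the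
induction work: a subtree may land in a slot larger than itself. *)
Lemma Lambda_embedding d k T : 1 < d -> is_dtree d T -> nverts T <= k ->
  exists g, rooted_embedding T (Lambda d k) g.
Proof.
move=> d1; elim/ltn_ind: k T => k IH [ts] /= /andP [szts dts].
rewrite nverts_Node; case: (ltnP 1 k) => [k1 sumts|k1 sumts]; last first.
  have -> : ts = [::].
    by case: ts sumts {szts dts} => //= t ts; have := nverts_gt0 t; lia.
  have -> : Lambda d k = leaf by case: k k1 {IH sumts} => [|[|]].
  by exists id; split=> // v i; [case: v | move=> j; case: v].
have [a [b [ab ->]]] := Lambda_slots d1 k1.
set K := maxn _ _; set c := (_ ++ _); have KE : K = maxn 1 (k - d) by [].
have c_lt j : j \in c -> j < k.
  by rewrite mem_cat inE mem_rev !mem_iota; lia.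
have s1 : all (leq 1) (map nverts ts).
  by rewrite all_map; apply/(all_nthP leaf) => i _; apply: nverts_gt0.
have [c' /subseq_pos [pos [posn posm]] sc'] : fits (map nverts ts) c.
  apply: fits_slots.
    apply/(all_nthP 0) => i; rewrite size_map => its; rewrite (nth_map leaf) //.
    by have := nverts_nth its; rewrite nverts_Node; lia.
  (* There are [minn d k.-1] slots: no item exceeds [K] and there are at most
     [d] of them, or else the room is at most [k.-1 - K.-1]. *)
  have K0 : 0 < K by lia.
  by have := (size_le_sumn s1, sum_room s1 K0) => -[]; rewrite size_map; lia.
move: sc'; rewrite all2E size_map => /andP [/eqP szc /(all_nthP (0, 0)) sc'].
rewrite -szc in posn posm.
apply: (@rooted_embedding_node _ _ pos) => // i its.
have [posc cE] := posn i its; rewrite size_map; split=> //.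
rewrite (nth_map 0) // -cE; apply: IH.
- by rewrite cE; apply/c_lt/mem_nth.
- exact: (all_nthP leaf dts).
- have := sc' i; rewrite size_zip size_map -szc minnn => /(_ its).
  by rewrite nth_zip ?size_map //= (nth_map leaf).
Qed.

Lemma Lambda_dtree d k : 1 < d -> is_dtree d (Lambda d k).
Proof.
move=> d1; elim/ltn_ind: k => k IH; case: (ltnP 1 k) => [k1|]; last first.
  by case: k IH => [|[|]].
have [a [b [ab ->]]] := Lambda_slots d1 k1.
rewrite /= size_map size_cat /= size_rev !size_iota; apply/andP; split; first by lia.
rewrite all_map; apply/allP => j jc /=; apply: IH.
by move: jc; rewrite mem_cat inE mem_rev !mem_iota; lia.
Qed.

Lemma Lambda_universal d k : 1 < d -> con_universal d k (Lambda d k).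
Proof.
move=> d1; split; first exact: Lambda_dtree.
move=> T dT /eq_leq szT; have [g gP] := Lambda_embedding d1 dT szT.
exact: rooted_embedding_contains gP.
Qed.

Lemma Ncon_le_L d k : 1 < d -> Ncon d k <= L_ d k.
Proof.
move=> d1; rewrite /Ncon; case: ex_minnP => n _; apply; apply/asboolP.
by exists (Lambda d k); split=> //; apply: Lambda_universal.
Qed.

(** * The growth of the vertex numbers *)

Lemma sum_nat_sub (F : nat -> nat) k a n : a + n <= k.+1 ->
  \sum_(a <= i < a + n) F (k - i) = \sum_(k.+1 - (a + n) <= j < k.+1 - a) F j.
Proof.
elim: n => [|n IH] an; first by rewrite !addn0 !big_geq.
rewrite addnS big_nat_recr ?leq_addr //= IH; last by lia.
rewrite [RHS]big_ltn; last by lia.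
by rewrite addnC subSS; congr (_ + \sum_(_ <= j < _) _); lia.
Qed.

Lemma L_rec d k : 1 < d -> d < k ->
  L_ d k = 1 + (L_ d k.-1 + \sum_(d./2 + 2 <= i < d.+1) L_ d (k - i)
                         + \sum_(uphalf d + 1 <= i < d.+1) L_ d (k - i)).
Proof.
move=> d1 dk; rewrite {1}/L_ Lambda_large // nverts_Node map_cat sumn_cat /=.
rewrite -!map_comp !map_rev sumn_rev !sumnE !big_map.
have sumE a : a <= d.+1 ->
    \sum_(k - d <= j < k.+1 - a) nverts (Lambda d j) =
    \sum_(a <= i < d.+1) L_ d (k - i).
  move=> ad; have -> : d.+1 = a + (d.+1 - a) by lia.
  rewrite sum_nat_sub; last by lia.
  by rewrite (_ : k.+1 - (a + (d.+1 - a)) = k - d) //; lia.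
rewrite -!sumE; [|lia..].
rewrite (_ : k.+1 - (d./2 + 2) = k - d./2 - 1); last by lia.
rewrite (_ : k.+1 - (uphalf d + 1) = k - uphalf d); last by lia.
by rewrite add1n addnCA addnA.
Qed.

Local Open Scope classical_set_scope.
Local Open Scope ring_scope.

(** The homogeneous part of the recurrence [L_rec]. *)
Definition shift_sum (R : realType) (d : nat) (F : nat -> R) (k : nat) : R :=
  F k.-1 + \sum_(d./2 + 2 <= i < d.+1) F (k - i)%N
         + \sum_(uphalf d + 1 <= i < d.+1) F (k - i)%N.

Lemma shift_sum_le (R : realType) d (F G : nat -> R) k : (1 < d < k)%N ->
  (forall j, (j < k)%N -> F j <= G j) -> shift_sum d F k <= shift_sum d G k.
Proof.
move=> dk FG; rewrite /shift_sum !lerD ?FG //; first by lia.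
all: by apply: ler_sum_nat => i id; apply: FG; lia.
Qed.

Lemma shift_sum_geom (R : realType) d k (x c : R) : (1 < d < k)%N ->
  0 < x -> root (p_ R d) x ->
  shift_sum d (fun j => c / x ^+ j) k = c / x ^+ k.
Proof.
move=> dk x0 /rootP; rewrite horner_p => px.
have xV j : (j <= k)%N -> c / x ^+ (k - j) = c / x ^+ k * x ^+ j.
  move=> jk; rewrite -{2}(subnK jk) exprD invfM mulrA divfK //.
  by rewrite expf_neq0 // gt_eqF.
rewrite /shift_sum -subn1 xV; last by lia.
have sumE a : \sum_(a <= i < d.+1) c / x ^+ (k - i) =
    c / x ^+ k * \sum_(a <= i < d.+1) x ^+ i.
  by rewrite mulr_sumr; apply: eq_big_nat => i id; apply: xV; lia.
rewrite !sumE -!mulrDr expr1 -[RHS]mulr1; congr (_ * _); lra.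
Qed.

Section Bounds.
Variables (R : realType) (d : nat).
Hypothesis d1 : (1 < d)%N.
Let x := x_ R d.

Lemma x_gt0 : 0 < x. Proof. by have [] := x_P R d. Qed.
Lemma x_root : root (p_ R d) x. Proof. by have [] := x_P R d. Qed.
Lemma x_le1 : x <= 1.
Proof.
have := x_gt0; have /rootP := x_root; rewrite horner_p => px x0.
have sum_ge0 a b : 0 <= \sum_(a <= i < b) x ^+ i.
  by apply: sumr_ge0 => i _; rewrite exprn_ge0 // ltW.
have := sum_ge0 (d./2 + 2)%N d.+1; have := sum_ge0 (uphalf d + 1)%N d.+1; lra.
Qed.

Lemma L_recR k : (d < k)%N ->
  (L_ d k)%:R = 1 + shift_sum d (fun j => (L_ d j)%:R) k :> R.
Proof. by move=> dk; rewrite L_rec // !natrD !natr_sum. Qed.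

Lemma L_ge k : x ^+ d / x ^+ k <= (L_ d k)%:R.
Proof.
have x0 := x_gt0; elim/ltn_ind: k => k IH; have [kd|dk] := leqP k d.
  apply: (@le_trans _ _ 1); last by rewrite ler1n; apply: nverts_gt0.
  by rewrite ler_pdivrMr ?exprn_gt0 // mul1r ler_wiXn2l ?x_le1 ?ltW.
rewrite L_recR // -(@shift_sum_geom R d k x); rewrite ?d1 ?dk ?x_root //.
have := @shift_sum_le R d _ _ k _ IH; rewrite d1 dk => /(_ isT); lra.
Qed.

(** The bound is proved for [L_ d k + 1]: the sum has [d] terms, so it gains [d] when
1 is added to each of them, and this covers the constant term 1 of the recurrence
and the added 1. *)
Lemma L_le : exists2 C : R, 0 < C & forall k, (L_ d k)%:R <= C / x ^+ k.
Proof.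
have x0 := x_gt0.
pose C := \sum_(j < d.+1) ((L_ d j)%:R + 1) : R.
have C_ge k : (k <= d)%N -> (L_ d k)%:R + 1 <= C.
  move=> kd; rewrite /C (bigD1 (Ordinal (kd : (k < d.+1)%N))) //= lerDl.
  by apply: sumr_ge0 => i _; rewrite addr_ge0.
have C0 : 0 < C by apply: lt_le_trans (C_ge 0%N _); rewrite ?ltr_wpDl.
have L1_le k : (L_ d k)%:R + 1 <= C / x ^+ k.
  elim/ltn_ind: k => k IH; have [kd|dk] := leqP k d.
    apply: le_trans (C_ge k kd) _.
    rewrite ler_pdivlMr ?exprn_gt0 // ler_piMr ?(ltW C0) //.
    by rewrite exprn_ile1 ?x_le1 ?ltW.
  rewrite L_recR // -(@shift_sum_geom R d k x); rewrite ?d1 ?dk ?x_root //.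
  have := @shift_sum_le R d _ _ k _ IH; rewrite d1 dk => /(_ isT).
  apply: le_trans; rewrite /shift_sum !big_split /= !sumr_const_nat.
  have : (1 : R) <= (d.+1 - (d./2 + 2))%:R + (d.+1 - (uphalf d + 1))%:R.
    by rewrite -natrD ler1n; lia.
  lra.
by exists C => // k; have := L1_le k; lra.
Qed.

Lemma L_root_cvg : (fun k => ln (L_ d k)%:R / k%:R) @ \oo --> ln (rho_ R d).
Proof.
have x0 := x_gt0; have [C C0 LC] := L_le.
have L0 k : 0 < (L_ d k)%:R :> R by rewrite ltr0n nverts_gt0.
have lnE c k : 0 < c -> ln (c / x ^+ k) = ln c + ln (rho_ R d) * k%:R.
  move=> c0; rewrite ln_div ?posrE ?exprn_gt0 // lnXn // lnV ?posrE // -/x.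
  by rewrite mulNr mulr_natr.
(* [x ^+ d] and [C] bound [L_ d k * x ^+ k] from below and above. *)
pose B := `|ln (x ^+ d)| + `|ln C|.
have lnB k : `|ln (L_ d k)%:R - ln (rho_ R d) * k%:R| <= B.
  have lo : ln (x ^+ d) + ln (rho_ R d) * k%:R <= ln (L_ d k)%:R.
    by rewrite -lnE ?exprn_gt0 // ler_ln ?posrE ?divr_gt0 ?exprn_gt0 ?L_ge.
  have hi : ln (L_ d k)%:R <= ln C + ln (rho_ R d) * k%:R.
    by rewrite -lnE // ler_ln ?posrE ?divr_gt0 ?exprn_gt0.
  have := lerNnormlW (lexx `|ln (x ^+ d)|); have := ler_norm (ln C).
  have := normr_ge0 (ln (x ^+ d)); have := normr_ge0 (ln C).
  by rewrite ler_norml /B; lra.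
apply/cvgrPdist_le => e e0.
near=> k.
have k0 : 0 < k%:R :> R by rewrite ltr0n; near: k; exists 1%N.
rewrite distrC -(ler_pM2r k0) -{2}(gtr0_norm k0) -normrM mulrBl divfK ?gt_eqF //.
apply: le_trans (lnB k) _; rewrite mulrC -ler_pdivrMr //.
near: k; exact: nbhs_infty_ger.
Unshelve. all: by end_near.
Qed.

Lemma L_asymptotic : exists2 e : nat -> R, e @ \oo --> (0 : R) &
  forall k, (1 <= k)%N -> (L_ d k)%:R = (rho_ R d + e k) ^+ k.
Proof.
have rho0 : 0 < rho_ R d by rewrite invr_gt0 x_gt0.
exists (fun k => expR (ln (L_ d k)%:R / k%:R) - rho_ R d).
  rewrite -(subrr (rho_ R d)); apply: cvgB; last exact: cvg_cst.
  rewrite -[X in _ --> X]lnK ?posrE //.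
  by apply: continuous_cvg L_root_cvg; apply: continuous_expR.
move=> k k1; rewrite addrC subrK -expRM_natr divfK ?pnatr_eq0 -?lt0n //.
by rewrite lnK // posrE ltr0n nverts_gt0.
Qed.

End Bounds.

(** * The position of the root for large d *)

Lemma horner_p_lt (R : realType) d (x y : R) : 0 < x -> x < y ->
  (p_ R d).[y] < (p_ R d).[x].
Proof.
move=> x0 xy.
have sum_le a b : \sum_(a <= i < b) x ^+ i <= \sum_(a <= i < b) y ^+ i.
  by apply: ler_sum => i _; rewrite lerXn2r ?nnegrE ?ltW // (lt_trans x0).
have := sum_le (d./2 + 2)%N d.+1; have := sum_le (uphalf d + 1)%N d.+1.
rewrite !horner_p; lra.
Qed.

Lemma rho_le (R : realType) d (r : R) : 0 < r ->
  0 <= (p_ R d).[r^-1] -> rho_ R d <= r.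
Proof.
move=> r0 pr; have x0 := x_gt0 R d; have /rootP px := x_root R d.
rewrite invf_ple ?posrE // leNgt; apply/negP => /(horner_p_lt d x0).
by rewrite px ltNge pr.
Qed.

Lemma le_rho (R : realType) d (r : R) : 0 < r ->
  (p_ R d).[r^-1] <= 0 -> r <= rho_ R d.
Proof.
move=> r0 pr; have x0 := x_gt0 R d; have /rootP px := x_root R d.
rewrite invf_pge ?posrE // leNgt; apply/negP => lt.
have := horner_p_lt d _ lt; rewrite invr_gt0 px => /(_ r0); lra.
Qed.

Lemma sum_geom (R : realType) a d (u : R) : 0 < u -> (a <= d)%N ->
  \sum_(a + 1 <= i < d.+1) (1 + u)^-1 ^+ i =
  ((1 + u)^-1 ^+ a - (1 + u)^-1 ^+ d) / u.
Proof.
move=> u0 ad; rewrite addn1 big_add1 /=; set y := (1 + u)^-1.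
have step i : y ^+ i.+1 = (- (y ^+ i.+1 / u)) - (- (y ^+ i / u)).
  rewrite !exprS /y; field; lra.
rewrite (eq_bigr _ (fun i _ => step i)) telescope_sumr //.
have := mulrBl (u^-1) (y ^+ a) (y ^+ d); lra.
Qed.

(** With [y = (1 + u)^-1] one has [1 - y = u y], and each of the two sums is at most
[y ^+ m / u], where [m = uphalf d].  The inequality [y <= expR (- (u y))] and
[u y >= u - u ^+ 2] turn the hypothesis into [4 y ^+ m <= u ^+ 2]; as [2 y >= 1],
each sum is at most [u y / 2]. *)
Lemma rho_upper (R : realType) d (u : R) : (1 < d)%N -> 0 < u <= 1 ->
  4 * expR (- ((u - u ^+ 2) * (d%:R / 2))) <= u ^+ 2 -> rho_ R d <= 1 + u.
Proof.
move=> d1; have /and3P [md1 md2 dE] :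
    [&& uphalf d <= d./2 + 1 <= d, uphalf d <= uphalf d <= d
      & d./2 + 2 == d./2 + 1 + 1]%N by lia.
move=> /andP [u0 u1] ub; apply: rho_le; first by lra.
set m := uphalf d; set y := (1 + u)^-1.
have y0 : 0 < y by rewrite invr_gt0; lra.
have yE : y = 1 - u * y by rewrite /y; field; lra.
have y1 : y <= 1 by rewrite yE; nra.
have yhalf : 1 <= 2 * y by rewrite yE; nra.
have uy : u - u ^+ 2 <= u * y by rewrite yE; nra.
have md : d%:R / 2 <= m%:R :> R.
  by rewrite ler_pdivrMr // -natrM ler_nat /m; clear; lia.
have ym : y ^+ m <= expR (- ((u - u ^+ 2) * (d%:R / 2))).
  apply: (@le_trans _ _ (expR (- (u * y)) ^+ m)).
    rewrite lerXn2r ?nnegrE ?expR_ge0 ?(ltW y0) //.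
    by have := expR_ge1Dx (- (u * y)); lra.
  rewrite -expRM_natr ler_expR mulNr lerN2.
  have d0 : 0 <= d%:R :> R by [].
  have : 0 <= u * y by rewrite mulr_ge0 // ltW.
  nra.
have ymy k : (m <= k)%N -> y ^+ k <= y ^+ m by move=> mk; rewrite ler_wiXn2l ?(ltW y0).
have yd : 0 < y ^+ d by rewrite exprn_gt0.
have S_le a : (m <= a <= d)%N -> \sum_(a + 1 <= i < d.+1) y ^+ i <= u * y / 2.
  move=> /andP [ma ad]; rewrite /y sum_geom // -/y ler_pdivrMr //.
  by have := ymy a ma; nra.
rewrite horner_p (eqP dE); have := S_le _ md1; have := S_le _ md2; lra.
Qed.

Lemma bernoulli (R : realType) n (u : R) : 0 <= u -> 1 + u * n%:R <= (1 + u) ^+ n.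
Proof.
move=> u0; elim: n => [|n IH]; first by rewrite mulr0 addr0.
by rewrite exprS -natr1; have : 0 <= n%:R :> R by []; nra.
Qed.

(** The second sum alone already reaches [1 - y = u y], where [y = (1 + u)^-1].  The
lower bound on [(1 + u) ^+ d./2] says that cutting the geometric series after the
term of degree [d] loses at most half of it. *)
Lemma rho_lower (R : realType) d (u : R) : (1 < d)%N -> 0 < u ->
  2 <= (1 + u) ^+ d./2 ->
  2 * u ^+ 2 * expR (u * (d%:R / 2 + 1 / 2)) <= 1 -> 1 + u <= rho_ R d.
Proof.
move=> d1; have /and3P [dE ud ud1] : [&& d == uphalf d + d./2, uphalf d <= d
    & 2 * uphalf d <= d + 1]%N by lia.
move=> u0 u2 ub; apply: le_rho; first by lra.
set y := (1 + u)^-1.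
have y0 : 0 < y by rewrite invr_gt0; lra.
have yE : y = 1 - u * y by rewrite /y; field; lra.
have y1 : y <= 1 by rewrite yE; nra.
have md : (uphalf d)%:R <= d%:R / 2 + 1 / 2 :> R.
  have : (2 * uphalf d)%:R <= (d + 1)%:R :> R by rewrite ler_nat.
  rewrite natrM natrD; lra.
have ym : 2 * u ^+ 2 <= y ^+ (uphalf d).
  rewrite /y exprVn -[leRHS]mul1r ler_pdivlMr ?exprn_gt0 //; last by lra.
  apply: le_trans ub; rewrite ler_pM2l; last by nra.
  apply: (@le_trans _ _ (expR u ^+ uphalf d)).
    by rewrite lerXn2r ?nnegrE ?expR_ge0 ?expR_ge1Dx //; lra.
  by rewrite -expRM_natr ler_expR ler_pM2l.
have yd : y ^+ d <= y ^+ (uphalf d) / 2.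
  rewrite {1}(eqP dE) exprD ler_pM2l ?exprn_gt0 // /y exprVn lef_pV2 ?posrE ?exprn_gt0 //; lra.
have S1 : 0 <= \sum_(d./2 + 2 <= i < d.+1) y ^+ i.
  by apply: sumr_ge0 => i _; rewrite exprn_ge0 // ltW.
have S2 : u * y <= \sum_(uphalf d + 1 <= i < d.+1) y ^+ i.
  rewrite /y sum_geom //.
  by rewrite -/y ler_pdivlMr //; nra.
rewrite horner_p; lra.
Qed.

(** Here [216] makes [ln d] and [d] large enough for [2 ll <= l] and
[36 l ^+ 2 <= d], by truncating the exponential series; [64] gives
[expR (delta * ll / 2)] a margin over the constants left in [rho_upper] and
[rho_lower]. *)
Lemma rho_bounds (R : realType) d (delta : R) :
  let l := ln (d%:R : R) in let ll := ln l in
  0 < delta <= 1 -> 216 <= ll -> 64 <= delta * ll ->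
  `|rho_ R d - (1 + 4 * l / d%:R - 4 * ll / d%:R)| <= delta * (ll / d%:R).
Proof.
move=> l ll /andP [dl0 dl1] ll216 dll.
have l1 : 1 < l by rewrite ltNge; apply/negP => /ln_le0; rewrite -/ll; lra.
have dR1 : 1 < d%:R :> R by rewrite ltNge; apply/negP => /ln_le0; rewrite -/l; lra.
have d1 : (1 < d)%N by rewrite -(ltr_nat R).
have d4 : (d <= 4 * d./2)%N by move: d1; clear; lia.
have lE : expR ll = l by rewrite lnK // posrE; lra.
have dE : expR l = d%:R by rewrite lnK // posrE; lra.
have l_big : 2 * ll <= l.
  have ll0 : 0 <= ll by lra.
  by have := expR_ge1Dxn 1 ll0; rewrite lE (_ : 2`!%:R = 2) //; nra.
have d_big : 36 * l ^+ 2 <= d%:R.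
  have l0 : 0 <= l by lra.
  have := expR_ge1Dxn 2 l0; rewrite dE (_ : 3`!%:R = 6) // exprS.
  have : 0 <= l ^+ 2 by rewrite exprn_ge0.
  nra.
set D := d%:R in dR1 dE d_big *.
have D0 : D != 0 by lra.
(* The choice [u = 4 (l - ll) / D] is made for this identity: [(D / l) ^+ 2] is of
   the order of [u ^- 2]. *)
have ratio : expR (2 * l - 2 * ll) = D ^+ 2 / l ^+ 2.
  by rewrite expRD expRN !expRM_natl dE lE.
set u0 := (l - ll) / D.
have u0D : u0 * D = l - ll by rewrite /u0 divfK.
set v := delta * (ll / D).
have vD : v * D = delta * ll by rewrite /v -mulrA divfK.
set q := l / D.
have qD : q * D = l by rewrite /q divfK.
have Dgt0 : 0 < D by lra.
have dll_le : delta * ll <= ll by nra.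
have q0 : 0 < q by rewrite divr_gt0; lra.
have q2D : 36 * q ^+ 2 * D <= 1.
  have sqE : 36 * q ^+ 2 * D * D = 36 * (q * D) ^+ 2 by ring.
  have : 36 * q ^+ 2 * D * D <= D by rewrite sqE qD.
  by rewrite ger_pMl.
have v0 : 0 < v by rewrite /v mulr_gt0 // divr_gt0 //; lra.
have uq : 4 * u0 + v <= 4 * q by rewrite -(ler_pM2r Dgt0); lra.
have uq' : 2 * q <= 4 * u0 + v by rewrite -(ler_pM2r Dgt0); lra.
have wq : q <= 4 * u0 - v by rewrite -(ler_pM2r Dgt0); lra.
have q1 : 4 * q <= 1.
  have : 4 * q * D <= 1 * D by rewrite -mulrA qD; nra.
  by rewrite ler_pM2r.
have up : rho_ R d <= 1 + (4 * u0 + v).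
  apply: rho_upper => //; first by apply/andP; split; lra.
  set u := 4 * u0 + v in uq uq' *.
  have uD : u * D = 4 * (l - ll) + delta * ll by rewrite /u mulrDl -mulrA u0D vD.
  have u2D : u ^+ 2 * D <= 1 by apply: le_trans q2D; rewrite ler_pM2r //; nra.
  apply: (@le_trans _ _ (4 * expR (- (2 * l - 2 * ll)))).
    by rewrite ler_pM2l // ler_expR; rewrite -/D; nra.
  rewrite expRN ratio invf_div -expr_div_n -/q; nra.
have low : 1 + (4 * u0 - v) <= rho_ R d.
  set u := 4 * u0 - v in wq *.
  have uD : u * D = 4 * (l - ll) - delta * ll by rewrite /u mulrBl -mulrA u0D vD.
  have u4q : u <= 4 * q by rewrite /u; lra.
  apply: rho_lower => //; first by lra.
    apply: le_trans (bernoulli _ _); last by lra.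
    have : D <= 4 * (d./2)%:R by rewrite -natrM ler_nat.
    have : q * D <= u * D by rewrite ler_pM2r.
    nra.
  apply: (@le_trans _ _ (2 * (16 * q ^+ 2) * expR (2 * l - 2 * ll - 31))).
    apply: ler_pM; rewrite ?expR_ge0 //; [nra|nra|].
    by rewrite ler_expR -/D; nra.
  rewrite expRD ratio expRN -expr_div_n -[D / l]invf_div -/q.
  have e31 : 32 <= expR 31 :> R by have := expR_ge1Dx (31 : R); lra.
  have -> : 2 * (16 * q ^+ 2) * (q^-1 ^+ 2 * (expR 31)^-1) = 32 / expR 31.
    by field; rewrite !gt_eqF ?expR_gt0.
  by rewrite ler_pdivrMr ?expR_gt0 // mul1r.
rewrite (_ : 1 + _ - _ = 1 + 4 * u0).
  by rewrite ler_distl; apply/andP; split; lra.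
by rewrite /u0; lra.
Qed.

Lemma rho_asymptotic (R : realType) :
  (fun d : nat => rho_ R d) =
    (fun d : nat => 1 + 4 * ln (d%:R : R) / d%:R - 4 * ln (ln d%:R) / d%:R)
    +o_\oo (fun d : nat => ln (ln (d%:R : R)) / d%:R).
Proof.
(* [rho_bounds] requires [delta <= 1], and it is stronger for smaller [delta]. *)
apply/eqaddoP => e e0; pose delta := Num.min e 1.
have delta0 : 0 < delta by rewrite lt_min e0 ltr01.
pose M := Num.max 216 (64 / delta).
near=> d.
have M0 : 0 < M by rewrite lt_max ltr0n.
have ddl : expR (expR M) <= d%:R by near: d; exact: nbhs_infty_ger.
have d0 : 0 < d%:R :> R by apply: lt_le_trans ddl; rewrite expR_gt0.
have ldl : expR M <= ln (d%:R : R) by rewrite -ler_expR lnK.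
have l0 : 0 < ln (d%:R : R) by apply: lt_le_trans ldl; rewrite expR_gt0.
have lll : M <= ln (ln (d%:R : R)) by rewrite -ler_expR lnK.
have ll0 : 0 <= ln (ln (d%:R : R)) / d%:R.
  by rewrite divr_ge0 ?(ltW d0) // (le_trans _ lll) // ltW.
rewrite (ger0_norm ll0); apply: le_trans (_ : delta * (ln (ln (d%:R : R)) / d%:R) <= _).
  apply: rho_bounds.
  - by rewrite delta0 ge_min lexx orbT.
  - by apply: le_trans lll; rewrite le_max lexx.
  - by rewrite mulrC -ler_pdivrMr //; apply: le_trans lll; rewrite le_max lexx orbT.
by rewrite ler_wpM2r // ge_min lexx.
Unshelve. all: by end_near.
Qed.

Theorem corollary3p4 (R : realType) :
  (forall d : nat, (2 <= d)%N ->
     (forall k : nat, (1 <= k)%N -> (Ncon d k <= L_ d k)%N) /\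
     (exists2 e : nat -> R, e @ \oo --> (0 : R) &
        forall k : nat, (1 <= k)%N -> (L_ d k)%:R = (rho_ R d + e k) ^+ k)) /\
  (fun d : nat => rho_ R d) =
    (fun d : nat => 1 + 4 * ln (d%:R : R) / d%:R - 4 * ln (ln d%:R) / d%:R)
    +o_\oo (fun d : nat => ln (ln (d%:R : R)) / d%:R).
Proof.
split; last exact: rho_asymptotic.
move=> d d1; split; last exact: L_asymptotic.
by move=> k _; apply: Ncon_le_L.
Qed.
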